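(* Let $k$ be a field, let $0<a_1<a_2<\cdots<a_q$ be integers with $\gcd(a_1,\ldots,a_q)=1$, and let $R=k[[t^{a_1},t^{a_2},\ldots,t^{a_q}]]\subseteq V=k[[t]]$, with multiplicity $e=a_1$. Assume that $r(R)=3$ and that the canonical module of $R$ can be written as $K_R=\langle 1,t^a,t^b\rangle\subseteq V$ with integers $0<a<b$. Suppose that $b\neq 2a$ and $b<e$. Let $J$ be an ideal of $R$ and let $n\ge 1$ be an integer. If $J^n\cong K_R$ as $R$-modules, then $n=1$.
   Context: $r(R)$ denotes the Cohen-Macaulay type of $R$, i.e. the minimal number of generators of its canonical module $K_R$. $\langle f_1,\ldots,f_m\rangle$ denotes the $R$-submodule of $V$ generated by $f_1,\ldots,f_m$; the equality $K_R=\langle 1,t^a,t^b\rangle$ means that this $R$-submodule of $V$ is a canonical module of $R$. *)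

(* Defs.v *)
From HB Require Import structures.
From mathcomp Require Import all_boot all_order all_algebra.
From mathcomp Require Import boolp classical_sets.

Set Implicit Arguments.
Unset Strict Implicit.
Unset Printing Implicit Defensive.

Import GRing.Theory.
Local Open Scope ring_scope.

(* Formal power series k[[t]], given by their coefficients. *)
Record fps (k : comNzRingType) := Fps { fpscoef : nat -> k }.

HB.instance Definition _ (k : comNzRingType) := gen_eqMixin (fps k).
HB.instance Definition _ (k : comNzRingType) := gen_choiceMixin (fps k).

Section Fps.
Variable k : comNzRingType.
Implicit Types f g h : fps k.

Lemma fpsP f g : (forall n, fpscoef f n = fpscoef g n) -> f = g.
Proof. by case: f g => [f] [g] /= /funext ->. Qed.

Definition fps0 : fps k := Fps (fun=> 0).
Definition fps_opp f : fps k := Fps (fun n => - fpscoef f n).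
Definition fps_add f g : fps k := Fps (fun n => fpscoef f n + fpscoef g n).
Definition fpsXn (m : nat) : fps k := Fps (fun n => (n == m)%:R).
Definition fps_mul f g : fps k :=
  Fps (fun n => \sum_(i < n.+1) fpscoef f i * fpscoef g (n - i)).

Fact fps_addA : associative fps_add.
Proof. by move=> f g h; apply: fpsP => n /=; rewrite addrA. Qed.
Fact fps_addC : commutative fps_add.
Proof. by move=> f g; apply: fpsP => n /=; rewrite addrC. Qed.
Fact fps_add0 : left_id fps0 fps_add.
Proof. by move=> f; apply: fpsP => n /=; rewrite add0r. Qed.
Fact fps_addN : left_inverse fps0 fps_opp fps_add.
Proof. by move=> f; apply: fpsP => n /=; rewrite addNr. Qed.

HB.instance Definition _ :=
  GRing.isZmodule.Build (fps k) fps_addA fps_addC fps_add0 fps_addN.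

Definition fps_trunc N f : {poly k} := \poly_(i < N) fpscoef f i.

Lemma fps_mul_trunc N f g n : (n < N)%N ->
  fpscoef (fps_mul f g) n = (fps_trunc N f * fps_trunc N g)`_n.
Proof.
move=> nN; rewrite coefM /=; apply: eq_bigr => i _; rewrite !coef_poly.
by rewrite (leq_ltn_trans _ nN) ?leq_ord // (leq_ltn_trans (leq_subr _ _) nN).
Qed.

Lemma coef_mul_ext (p p' q q' : {poly k}) n :
    (forall i, (i <= n)%N -> p`_i = p'`_i) ->
    (forall i, (i <= n)%N -> q`_i = q'`_i) ->
  (p * q)`_n = (p' * q')`_n.
Proof.
move=> pE qE; rewrite !coefM; apply: eq_bigr => i _.
by rewrite pE ?leq_ord // qE ?leq_subr.
Qed.

Fact fps_mulC : commutative fps_mul.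
Proof.
by move=> f g; apply: fpsP => n; rewrite !(@fps_mul_trunc n.+1) // mulrC.
Qed.

Fact fps_mulA : associative fps_mul.
Proof.
move=> f g h; apply: fpsP => n; rewrite !(@fps_mul_trunc n.+1) //.
transitivity ((fps_trunc n.+1 f * (fps_trunc n.+1 g * fps_trunc n.+1 h))`_n).
  apply: coef_mul_ext => // i le_in.
  by rewrite coef_poly ltnS le_in (@fps_mul_trunc n.+1).
rewrite mulrA; apply: coef_mul_ext => // i le_in.
by rewrite coef_poly ltnS le_in (@fps_mul_trunc n.+1).
Qed.

Fact fps_mul1 : left_id (fpsXn 0) fps_mul.
Proof.
move=> f; apply: fpsP => n /=; rewrite big_ord_recl /= mul1r subn0 big1 ?addr0 //.
by move=> i _; rewrite mul0r.
Qed.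

Fact fps_mulDl : left_distributive fps_mul fps_add.
Proof.
move=> f g h; apply: fpsP => n /=; rewrite -big_split /=.
by apply: eq_bigr => i _; rewrite mulrDl.
Qed.

Fact fps_1neq0 : fpsXn 0 != 0.
Proof.
by apply/eqP => /(congr1 (fun f => fpscoef f 0)) /= /eqP; rewrite oner_eq0.
Qed.

HB.instance Definition _ :=
  GRing.Zmodule_isComNzRing.Build (fps k)
    fps_mulA fps_mulC fps_mul1 fps_mulDl fps_1neq0.

End Fps.

(* An alias of k[[t]] that carries the module structure over the subring      *)
(* determined by s.                                                           *)
Definition fps_over (k : comNzRingType) (q : nat) (s : 'I_q -> nat) : Type :=
  fps k.
HB.instance Definition _ (k : comNzRingType) (q : nat) (s : 'I_q -> nat) :=
  GRing.Zmodule.copy (fps_over k s) (fps k).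

(* The ring k[[t^{s_0}, ..., t^{s_{q-1}}]], i.e. the image of the substitution *)
(* k[[X_0, ..., X_{q-1}]] -> k[[t]], X_i |-> t^{s_i}.  A series in the X_i is  *)
(* given by its coefficients c, indexed by exponent vectors.  When all s_i are *)
(* positive, sum_i al_i s_i = n forces al_i <= n, so the sums below run over   *)
(* all exponent vectors of weight n.                                           *)
Section SemigroupRing.
Variables (k : comNzRingType) (q : nat) (s : 'I_q -> nat).

Definition weight n (al : {ffun 'I_q -> 'I_n.+1}) : nat :=
  (\sum_i al i * s i)%N.

Definition subst_monomials (c : {ffun 'I_q -> nat} -> k) : fps k :=
  Fps (fun n => \sum_(al : {ffun 'I_q -> 'I_n.+1} | weight al == n)
                   c [ffun i => al i : nat]).

Definition sgring_pred : {pred fps k} :=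
  fun f => `[< exists c, f = subst_monomials c >].

Lemma sgring_predP f :
  reflect
    (forall n, fpscoef f n != 0 ->
       exists al : {ffun 'I_q -> 'I_n.+1}, weight al = n)
    (f \in sgring_pred).
Proof.
apply: (iffP idP) => [/asboolP[c ->] n /= | supp].
  case: (pickP [pred al : {ffun 'I_q -> 'I_n.+1} | weight al == n]) => [al|no].
    by move=> /eqP al_n _; exists al.
  by rewrite big_pred0 ?eqxx.
apply/asboolP.
pose rep n := [pick al : {ffun 'I_q -> 'I_n.+1} | weight al == n].
pose vals n (al : {ffun 'I_q -> 'I_n.+1}) : {ffun 'I_q -> nat} :=
  [ffun i => al i : nat].
pose wt (be : {ffun 'I_q -> nat}) := (\sum_i be i * s i)%N.
pose c be := if rep (wt be) is Some al then
               if be == vals _ al then fpscoef f (wt be) else 0 else 0.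
exists c; apply: fpsP => n /=.
have wtE (al : {ffun 'I_q -> 'I_n.+1}) : weight al == n -> wt (vals n al) = n.
  by move=> /eqP e; rewrite -[RHS]e; apply: eq_bigr => i _; rewrite ffunE.
have vals_inj : injective (vals n).
  move=> al be /ffunP e; apply/ffunP => i; apply: val_inj.
  by have := e i; rewrite !ffunE.
case repn: (rep n) => [al|]; last first.
  have no_al : forall al : {ffun 'I_q -> 'I_n.+1}, weight al == n = false.
    by move: repn; rewrite /rep; case: pickP.
  rewrite big_pred0 //; apply/eqP/negPn/negP => /supp [al /eqP].
  by rewrite no_al.
have al_n : weight al == n.
  by move: repn; rewrite /rep; case: pickP => // x xn [<-].
rewrite (bigD1 al) //= big1 ?addr0 => [|be /andP[be_n neq]].
  by rewrite -/(vals n al) /c wtE // repn eqxx.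
by rewrite -/(vals n be) /c wtE // repn (inj_eq vals_inj) (negbTE neq).
Qed.

Fact sgring_subring_closed : subring_closed sgring_pred.
Proof.
split.
- apply/sgring_predP => n /=.
  have [-> _|_] := eqVneq n 0%N; last by rewrite eqxx.
  by exists [ffun=> ord0]; rewrite /weight big1 // => i _; rewrite ffunE.
- move=> f g /sgring_predP fS /sgring_predP gS; apply/sgring_predP => n /= nz.
  have [f0|] := eqVneq (fpscoef f n) 0; last exact: fS.
  by apply: gS; apply: contraNneq nz => ->; rewrite f0 subr0.
- move=> f g /sgring_predP fS /sgring_predP gS; apply/sgring_predP => n /= nz.
  have [i nzi] : exists i : 'I_n.+1, fpscoef f i * fpscoef g (n - i) != 0.
    apply/existsP; apply: contraNT nz => /existsPn z.
    by rewrite big1 // => i _; apply/eqP/negPn/z.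
  have [|al al_i] := fS i; first by apply: contraNneq nzi => ->; rewrite mul0r.
  have [|be be_i] := gS (n - i)%N.
    by apply: contraNneq nzi => ->; rewrite mulr0.
  have bound j : (al j + be j < n.+1)%N.
    rewrite ltnS -[X in (_ <= X)%N](subnKC (leq_ord i)).
    by rewrite leq_add ?leq_ord.
  exists [ffun j => Ordinal (bound j)]; rewrite /weight.
  transitivity (weight al + weight be)%N.
    rewrite /weight -big_split; apply: eq_bigr => j _.
    by rewrite ffunE /= mulnDl.
  by rewrite al_i be_i subnKC ?leq_ord.
Qed.

HB.instance Definition _ :=
  GRing.isSubringClosed.Build (fps k) sgring_pred sgring_subring_closed.

Record sgring := SgRing { sgval : fps k; _ : sgval \in sgring_pred }.

HB.instance Definition _ := [isSub for sgval].
HB.instance Definition _ := [Choice of sgring by <:].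
HB.instance Definition _ := [SubChoice_isSubComNzRing of sgring by <:].

Definition sg_scale (r : sgring) (v : fps_over k s) : fps_over k s := sgval r * v.

Fact sg_scaleA r r' v : sg_scale r (sg_scale r' v) = sg_scale (r * r') v.
Proof. by rewrite /sg_scale mulrA. Qed.
Fact sg_scale1 : left_id 1 sg_scale.
Proof. exact: mul1r. Qed.
Fact sg_scaleDr : right_distributive sg_scale +%R.
Proof. by move=> r v w; apply: mulrDr. Qed.
Fact sg_scaleDl v : {morph sg_scale^~ v : r r' / r + r'}.
Proof. by move=> r r'; apply: mulrDl. Qed.

HB.instance Definition _ :=
  GRing.Zmodule_isLmodule.Build sgring (fps_over k s)
    sg_scaleA sg_scale1 sg_scaleDr sg_scaleDl.

Definition tpow (m : nat) : fps_over k s := fpsXn k m.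

End SemigroupRing.

(* The submodule generated by a set, as a module in its own right *)
Section Span.
Variables (R : comNzRingType) (V : lmodType R) (S : set V).

Definition span_pred : {pred V} := fun v =>
  `[< exists n (r : 'I_n -> R) (x : 'I_n -> V),
        (forall i, S (x i)) /\ v = \sum_i r i *: x i >].

Fact span_submod_closed : submod_closed span_pred.
Proof.
split=> [|a u v].
  apply/asboolP; exists 0%N, (fun=> 0), (fun=> 0).
  by split=> [[]|]; rewrite ?big_ord0.
move=> /asboolP[m [r [x [Sx ->]]]] /asboolP[n [r' [y [Sy ->]]]].
apply/asboolP; exists (m + n)%N.
exists (fun i => match split i with inl j => a * r j | inr j => r' j end).
exists (fun i => match split i with inl j => x j | inr j => y j end).
split=> [i|]; first by case: split.
rewrite big_split_ord /= scaler_sumr; congr (_ + _); apply: eq_bigr => i _.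
  by rewrite (unsplitK (inl i)) scalerA.
by rewrite (unsplitK (inr i)).
Qed.

HB.instance Definition _ :=
  GRing.isSubmodClosed.Build R V span_pred span_submod_closed.

Record span_mod := SpanMod { spanval : V; _ : spanval \in span_pred }.

HB.instance Definition _ := [isSub for spanval].
HB.instance Definition _ := [Choice of span_mod by <:].
HB.instance Definition _ := [SubChoice_isSubLmodule of span_mod by <:].

End Span.

Section Modules.
Variable R : comNzRingType.

Definition lmod_iso (A B : lmodType R) : Prop :=
  exists f : {linear A -> B}, bijective f.

Definition generates (C : lmodType R) r (x : 'I_r -> C) : Prop :=
  forall c, exists a : 'I_r -> R, c = \sum_i a i *: x i.

Definition fin_generated (C : lmodType R) : Prop :=
  exists r (x : 'I_r -> C), generates x.

Definition min_generators (C : lmodType R) (r : nat) : Prop :=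
  (exists x : 'I_r -> C, generates x) /\
  (forall r' (x : 'I_r' -> C), generates x -> (r <= r')%N).

Definition injective_module (I : lmodType R) : Prop :=
  forall (A B : lmodType R) (i : {linear A -> B}) (f : {linear A -> I}),
    injective i -> exists g : {linear B -> I}, forall a, g (i a) = f a.

Fixpoint injdim_le (n : nat) (C : lmodType R) : Prop :=
  if n is n'.+1 then
    exists (I C' : lmodType R) (f : {linear C -> I}) (g : {linear I -> C'}),
      [/\ injective_module I,
          injective f,
          (forall x, g x = 0 <-> exists c, x = f c),
          (forall y, exists x, y = g x)
        & injdim_le n' C']
  else injective_module C.

(* The maximal ideal, when R is local. *)
Definition nonunits : set R := [set x | ~ exists y, x * y = 1].

Definition regular_on (C : lmodType R) (x : R) : Prop :=
  (forall c : C, x *: c = 0 -> c = 0) /\ (exists c : C, forall d, c <> x *: d).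

(* phi restricts to an R-linear map m -> C; its values outside m are junk. *)
Definition hom_on (m : set R) (C : lmodType R) (phi : R -> C) : Prop :=
  forall r x y, m x -> m y -> phi (r * x + y) = r *: phi x + phi y.

(* The presentation 0 -> m -> R -> R/m -> 0 gives                           *)
(*   Ext^1_R(R/m, C) = coker (C = Hom_R(R, C) -> Hom_R(m, C)).              *)
(* As m annihilates it, it is one-dimensional over R/m exactly when it is   *)
(* nonzero and generated by a single class as an R-module.                  *)
Definition ext1_residue_dim1 (C : lmodType R) : Prop :=
  let m := nonunits in
  exists phi : R -> C,
    [/\ hom_on m phi,
        ~ (exists c : C, forall x, m x -> phi x = x *: c)
      & forall psi : R -> C, hom_on m psi ->
          exists (r : R) (c : C),
            forall x, m x -> psi x = r *: phi x + x *: c].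

(* C is a canonical module of the one-dimensional Cohen-Macaulay local ring *)
(* R: a finitely generated maximal Cohen-Macaulay module (depth 1), of type *)
(* dim Ext^1(R/m, C) = 1 and of finite injective dimension.                 *)
Definition canonical_module (C : lmodType R) : Prop :=
  [/\ fin_generated C,
      (exists2 x, nonunits x & regular_on C x),
      ext1_residue_dim1 C
    & exists n, injdim_le n C].

(* The Cohen-Macaulay type of R is r.  Canonical modules are unique up to   *)
(* isomorphism.                                                             *)
Definition cm_type (r : nat) : Prop :=
  (exists C : lmodType R, canonical_module C) /\
  (forall C : lmodType R, canonical_module C -> min_generators C r).

Definition ideal_power (J : {pred R^o}) (n : nat) : lmodType R :=
  span_mod ([set x : R^o | exists y : 'I_n -> R,
              (forall i, y i \in J) /\ x = \prod_i y i])%classic.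

End Modules.

(* Main.v *)
(** Everything happens at the level of orders (t-adic valuations).  Suppose
    J^n is isomorphic to K with n > 1 and let f have minimal order in J: then
    I = J/f contains 1 and I^n = z K for a unit z of k[[t]], so a product of two
    elements of I has its order in the exponent set E of K, which meets [0, e)
    in {0, a, b}.  If I had no element of order a, or one, g, of order a but
    none of order b, then modulo a power of t it would lie in the ring k,
    resp. k + k g (g^2 vanishes there, since b <> 2a forces 2a > b), hence so
    would z K; this contradicts t^a, resp. t^b, being in K.  So I has elements
    of orders 0, a and b, every element of E is an order in I, and a + E is
    contained in E.  But Ext^1(R/m, K) being one-dimensional makes E dual to the
    value semigroup H of R, so a is in H, while 0 < a < e. *)

Require Import Defs.
From HB Require Import structures.
From mathcomp Require Import all_boot all_order all_algebra.
From mathcomp Require Import boolp classical_sets.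
From mathcomp Require Import zify.
Import GRing.Theory.
Local Open Scope ring_scope.

Set Implicit Arguments.
Unset Strict Implicit.
Unset Printing Implicit Defensive.

(** * Power series over a field: orders, inverses, divisibility, truncated subrings *)

Section PowerSeries.
Variable k : fieldType.
Implicit Types f g h : fps k.

Definition fpsC (c : k) : fps k := Fps (fun n => if n is 0%N then c else 0).

Definition fps_shift m f : fps k := Fps (fun n => fpscoef f (n + m)).

Definition has_order f n := fpscoef f n != 0 /\ forall i, (i < n)%N -> fpscoef f i = 0.

Lemma fpscoefM f g n :
  fpscoef (f * g) n = \sum_(i < n.+1) fpscoef f i * fpscoef g (n - i).
Proof. by []. Qed.

Lemma fpscoefD f g n : fpscoef (f + g) n = fpscoef f n + fpscoef g n.
Proof. by []. Qed.

Lemma fpscoefB f g n : fpscoef (f - g) n = fpscoef f n - fpscoef g n.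
Proof. by []. Qed.

Lemma fpscoefXn m n : fpscoef (fpsXn k m) n = (n == m)%:R.
Proof. by []. Qed.

Lemma fpscoef1 n : fpscoef (1 : fps k) n = (n == 0)%:R.
Proof. by []. Qed.

Lemma fpscoefM0 f g : fpscoef (f * g) 0 = fpscoef f 0 * fpscoef g 0.
Proof. by rewrite fpscoefM big_ord1. Qed.

Lemma fpscoefXnM m f n :
  fpscoef (fpsXn k m * f) n = if (m <= n)%N then fpscoef f (n - m) else 0.
Proof.
rewrite fpscoefM; case: leqP => [le_mn|lt_nm].
  have lt_mn : (m < n.+1)%N by [].
  rewrite (bigD1 (Ordinal lt_mn)) //= eqxx mul1r big1 ?addr0 // => i ne.
  by rewrite -val_eqE /= in ne; rewrite (negbTE ne) mul0r.
rewrite big1 // => i _; rewrite fpscoefXn.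
by rewrite ltn_eqF ?mul0r // (leq_ltn_trans _ lt_nm) ?leq_ord.
Qed.

Lemma fpsXnM m n : fpsXn k m * fpsXn k n = fpsXn k (m + n).
Proof.
apply: fpsP => i; rewrite fpscoefXnM !fpscoefXn.
case: leqP => [le_mi|lt_im]; first by rewrite -(eqn_add2l m) subnKC.
by rewrite ltn_eqF // (leq_trans lt_im) ?leq_addr.
Qed.

Lemma fpsXn_shift m f : (forall i, (i < m)%N -> fpscoef f i = 0) ->
  f = fpsXn k m * fps_shift m f.
Proof.
move=> f0; apply: fpsP => n; rewrite fpscoefXnM /=.
by case: leqP => [le_mn|/f0//]; rewrite subnK.
Qed.

Lemma fps_shiftXn m f : fps_shift m (fpsXn k m * f) = f.
Proof. by apply: fpsP => n; rewrite -[LHS]/(fpscoef _ (n + m)) fpscoefXnM leq_addl addnK. Qed.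

Lemma fpsXn_lreg m : GRing.lreg (fpsXn k m).
Proof. by move=> f g /(congr1 (fps_shift m)); rewrite !fps_shiftXn. Qed.

Lemma fps_shiftM m f g : (forall i, (i < m)%N -> fpscoef g i = 0) ->
  fps_shift m (f * g) = f * fps_shift m g.
Proof. by move=> /fpsXn_shift {1}->; rewrite mulrCA fps_shiftXn. Qed.

Lemma fpscoefCM c f n : fpscoef (fpsC c * f) n = c * fpscoef f n.
Proof.
rewrite fpscoefM big_ord_recl /= subn0 big1 ?addr0 // => i _.
by rewrite mul0r.
Qed.

Lemma has_order_exists f m : fpscoef f m != 0 ->
  exists2 n, (n <= m)%N & has_order f n.
Proof.
move=> fm; have ex : exists n, fpscoef f n != 0 by exists m.
case: (ex_minnP ex) => n fn min_n; exists n; first exact: min_n.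
split=> // i lt_in; apply/eqP/negPn/negP => /min_n.
by rewrite leqNgt lt_in.
Qed.

Lemma has_orderM f g m n :
  has_order f m -> has_order g n -> has_order (f * g) (m + n).
Proof.
move=> [fm f0] [gn g0]; rewrite (fpsXn_shift f0) (fpsXn_shift g0).
rewrite mulrACA fpsXnM; split=> [|i lt_i]; rewrite fpscoefXnM.
  by rewrite leqnn subnn fpscoefM0 /= mulf_neq0.
by rewrite leqNgt lt_i.
Qed.

Lemma has_orderXn m : has_order (fpsXn k m) m.
Proof.
split=> [|i lt_i]; rewrite fpscoefXn ?eqxx ?oner_neq0 //.
by rewrite ltn_eqF.
Qed.

(* [N] is the recursion fuel; the value does not depend on it once [n < N]. *)
Fixpoint fps_inv_rec f N n : k :=
  if N isn't N'.+1 then 0 else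
  if n isn't n'.+1 then (fpscoef f 0)^-1 else
  - (fpscoef f 0)^-1 * \sum_(i < n'.+1) fpscoef f i.+1 * fps_inv_rec f N' (n' - i)%N.

Definition fps_inv f : fps k := Fps (fun n => fps_inv_rec f n.+1 n).

Lemma fps_inv_rec_fuel f N N' n : (n < N)%N -> (n < N')%N ->
  fps_inv_rec f N n = fps_inv_rec f N' n.
Proof.
elim: N N' n => // N IH [] // N' [|n] //=; rewrite !ltnS => nN nN'.
congr (_ * _); apply: eq_bigr => i _; congr (_ * _).
by apply: IH; apply: (leq_ltn_trans (leq_subr _ _)).
Qed.

Lemma fps_invS f n : fpscoef (fps_inv f) n.+1 =
  - (fpscoef f 0)^-1 * \sum_(i < n.+1) fpscoef f i.+1 * fpscoef (fps_inv f) (n - i).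
Proof.
rewrite [LHS]/=; congr (_ * _); apply: eq_bigr => i _; congr (_ * _).
by apply: (@fps_inv_rec_fuel f n.+1 (n - i).+1); rewrite ltnS ?leq_subr.
Qed.

Lemma fps_mulV f : fpscoef f 0 != 0 -> f * fps_inv f = 1.
Proof.
move=> f0; apply: fpsP => -[|n]; first by rewrite fpscoefM0 /= mulfV.
rewrite fpscoefM big_ord_recl subn0 fps_invS mulNr mulrN mulVKf //.
by rewrite addNr fpscoef1.
Qed.

(** The recursion builds the coefficient at [n + 1] from products of a coefficient of [f] at [i + 1]
    and one of the inverse at [n - i], so additive closure of [H] propagates. This keeps inverses
    inside [R]. *)
Lemma fps_inv_supp (H : pred nat) f : H 0%N -> (forall m n, H m -> H n -> H (m + n)%N) ->
  (forall n, fpscoef f n != 0 -> H n) ->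
  forall n, fpscoef (fps_inv f) n != 0 -> H n.
Proof.
move=> H0 HD fH n; elim/ltn_ind: n => -[//|n] IH.
rewrite fps_invS; apply: contraNT => Hn; rewrite big1 ?mulr0 // => i _.
apply: contraNeq Hn; rewrite mulf_eq0 negb_or => /andP[/fH Hi /IH Hni].
rewrite -(subnKC (leq_ord i)) -addSn; apply: HD => //.
by apply: Hni; rewrite ltnS leq_subr.
Qed.

Lemma fps_lreg f m : fpscoef f m != 0 -> GRing.lreg f.
Proof.
case/has_order_exists => n _ [fn f0]; rewrite (fpsXn_shift f0).
apply: lregM; first exact: fpsXn_lreg.
have/fps_mulV fV : fpscoef (fps_shift n f) 0 != 0 by [].
by move=> x y /(congr1 ( *%R (fps_inv (fps_shift n f)))); rewrite !mulrA [fps_inv _ * _]mulrC fV !mul1r.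
Qed.

Lemma fps_dvd f g m : has_order f m -> (forall i, (i < m)%N -> fpscoef g i = 0) ->
  exists x, g = f * x.
Proof.
move=> [fm f0] g0; exists (fps_inv (fps_shift m f) * fps_shift m g).
by rewrite {1}(fpsXn_shift f0) mulrA -[_ * _ * fps_inv _]mulrA fps_mulV // mulr1 -fpsXn_shift.
Qed.

(* The series congruent modulo [t^(N+1)] to elements of [k + k g], when [g] has no constant term. *)
Definition trunc_line N g : {pred fps k} := fun f =>
  `[< exists be, forall i, (0 < i <= N)%N -> fpscoef f i = be * fpscoef g i >].

(** The hypothesis makes the square of the nonconstant part of [g] vanish modulo [t^(N+1)], so in a
    product only constant times line and line times constant survive. *)
Lemma trunc_line_subring N g :
  (forall i j, (0 < i)%N -> (0 < j)%N -> (i + j <= N)%N -> fpscoef g i * fpscoef g j = 0) ->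
  subring_closed (trunc_line N g).
Proof.
move=> gg; split.
- apply/asboolP; exists 0 => i /andP[i0 _].
  by rewrite fpscoef1 gtn_eqF // mul0r.
- move=> x y /asboolP[be xE] /asboolP[ga yE]; apply/asboolP; exists (be - ga) => i iN.
  by rewrite fpscoefB xE // yE // mulrBl.
move=> x y /asboolP[be xE] /asboolP[ga yE]; apply/asboolP.
exists (fpscoef x 0 * ga + be * fpscoef y 0) => -[//|i] iN.
rewrite fpscoefM big_ord_recl big_ord_recr /= subn0 subnn big1 => [|j _].
  by rewrite add0r /bump /= add1n yE // (xE i.+1) // mulrDl !mulrA (mulrAC be).

rewrite /bump /= add1n xE ?yE; try by have := ltn_ord j; lia.
by rewrite mulrACA gg ?mulr0 //; have := ltn_ord j; lia.
Qed.

End PowerSeries.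

(** * The value semigroup H of [R] *)

Section NumericalSemigroup.
Variables (q : nat) (s : 'I_q.+1 -> nat).

Definition semigroup : pred nat := fun n =>
  `[< exists c : 'I_q.+1 -> nat, n = (\sum_i c i * s i)%N >].

Lemma semigroup0 : semigroup 0%N.
Proof. by apply/asboolP; exists (fun=> 0%N); rewrite big1. Qed.

Lemma semigroupD m n : semigroup m -> semigroup n -> semigroup (m + n).
Proof.
move=> /asboolP[c ->] /asboolP[d ->]; apply/asboolP.
by exists (fun i => c i + d i)%N; rewrite -big_split; apply: eq_bigr => i _; rewrite mulnDl.
Qed.

Lemma semigroupM m n : semigroup n -> semigroup (m * n).
Proof.
by move=> Hn; elim: m => [|m IH]; rewrite ?mulSn ?mul0n ?semigroup0 // semigroupD.
Qed.

Lemma semigroup_gen i : semigroup (s i).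
Proof.
apply/asboolP; exists (fun j => (j == i : nat)); rewrite (bigD1 i) //= eqxx mul1n big1 ?addn0 //.
by move=> j /negbTE->.
Qed.

(** By Bezout, gcds of generators remain differences of two elements of H, so some [v] and
    [u = v + 1] lie in H. If [n >= v * v] has quotient q and remainder r modulo [v > 0], then q >= r
    and n = (q - r) v + r u. *)
Lemma semigroup_cofinite : \big[gcdn/0%N]_i s i = 1%N ->
  exists N, forall n, (N <= n)%N -> semigroup n.
Proof.
move=> s_gcd.
have [u [v [Hu Hv]]] : exists u v, [/\ semigroup u, semigroup v & u = v + \big[gcdn/0]_i s i]%N.
  apply: (big_ind (fun g => exists u v, [/\ semigroup u, semigroup v & u = v + g]%N)).
  - by exists 0%N, 0%N; rewrite semigroup0.
  - move=> m n [u1 [v1 [Hu1 Hv1 E1]]] [u2 [v2 [Hu2 Hv2 E2]]].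
    case: (posnP m) => [->|m_gt0]; first by exists u2, v2; rewrite gcd0n.
    case: (egcdnP n m_gt0) => x y xE _.
    exists (x * u1 + y * v2)%N, (x * v1 + y * u2)%N.
    split; [exact: semigroupD (semigroupM _ _) (semigroupM _ _).. |].
    by rewrite E1 E2 !mulnDr xE; lia.
  - by move=> i _; exists (s i), 0%N; rewrite semigroup_gen semigroup0.
rewrite s_gcd addn1 => uE; exists (v * v)%N => n le_n.
case: (posnP v) => [v0|v_gt0].
  by rewrite -[n]muln1 semigroupM //; rewrite uE v0 in Hu.
have -> : n = ((n %/ v - n %% v) * v + (n %% v) * u)%N.
  have lt_r : (n %% v < v)%N by rewrite ltn_mod.
  have le_q : (v <= n %/ v)%N by rewrite leq_divRL.
  by rewrite {1}(divn_eq n v) uE; nia.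
by rewrite semigroupD // semigroupM.
Qed.

Hypotheses (s_pos : (0 < s ord0)%N) (s_incr : forall i j : 'I_q.+1, (i < j)%N -> (s i < s j)%N).

Lemma gen_ge i : (s ord0 <= s i)%N.
Proof. by case: (posnP i) => [i0|/(@s_incr ord0)/ltnW//]; rewrite (_ : i = ord0) //; apply: val_inj. Qed.

Lemma semigroup_lt n : semigroup n -> (n < s ord0)%N -> n = 0%N.
Proof.
move=> /asboolP[c ->]; case: (pickP (fun i => c i != 0%N)) => [i ci|c0 _].
  rewrite ltnNge (bigD1 i) //= (leq_trans _ (leq_addr _ _)) //.
  by rewrite (leq_trans (gen_ge i)) // leq_pmull // lt0n.
by rewrite big1 // => i _; move/negbFE/eqP: (c0 i) => ->.
Qed.

Lemma sgring_suppP (k : fieldType) (f : fps k) :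
  reflect (forall n, fpscoef f n != 0 -> semigroup n) (f \in sgring_pred s).
Proof.
apply: (iffP (sgring_predP s f)) => supp n /supp.
  by case=> al <-; apply/asboolP; exists (fun i => al i : nat).
case/asboolP=> c nE.
have c_le i : (c i < n.+1)%N.
  rewrite ltnS nE (bigD1 i) //= (leq_trans _ (leq_addr _ _)) // leq_pmulr //.
  exact: leq_trans (gen_ge i).
by exists [ffun i => Ordinal (c_le i)]; rewrite [RHS]nE; apply: eq_bigr => i _; rewrite ffunE.
Qed.

End NumericalSemigroup.

(** * Duality between H and the exponents of a monomial module with one-dimensional Ext^1(R/m, K) *)

Section CanonicalSemigroupModule.
Variables (k : fieldType) (q : nat) (s : 'I_q.+1 -> nat).
Hypotheses (s_pos : (0 < s ord0)%N) (s_incr : forall i j : 'I_q.+1, (i < j)%N -> (s i < s j)%N).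
Let R : comNzRingType := sgring k s.
Let e := s ord0.

Lemma sgvalP (r : R) n : fpscoef (sgval r) n != 0 -> semigroup s n.
Proof. by move: n; apply/sgring_suppP => //; apply: valP r. Qed.

Lemma sgval_small (r : R) n : (0 < n < e)%N -> fpscoef (sgval r) n = 0.
Proof.
case/andP=> n0 lt_ne; apply/eqP/negPn/negP => /sgvalP /semigroup_lt nE.
by rewrite nE in n0.
Qed.

Lemma sgval_exists (f : fps k) : (forall n, fpscoef f n != 0 -> semigroup s n) ->
  exists r : R, sgval r = f.
Proof. by move=> /sgring_suppP-/(_ s_pos s_incr) Rf; exists (SgRing Rf). Qed.

Lemma sgvalXn n : semigroup s n -> exists r : R, sgval r = fpsXn k n.
Proof.
move=> Hn; apply: sgval_exists => m; rewrite fpscoefXn.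
by case: (eqVneq m n) => [->|_] //; rewrite eqxx.
Qed.

Lemma sgvalC c : exists r : R, sgval r = fpsC c.
Proof. by apply: sgval_exists => -[|n] /=; rewrite ?eqxx // semigroup0. Qed.

(** A series of [R] with nonzero constant term has an inverse in [k[[t]]], whose support stays in
    H. *)
Lemma nonunitsP (r : R) : nonunits r <-> fpscoef (sgval r) 0 = 0.
Proof.
split=> [nu|r0 [y ry]]; last first.
  have /eqP := congr1 (fun x : R => fpscoef (sgval x) 0) ry.
  by rewrite [X in X == _]fpscoefM0 r0 mul0r eq_sym oner_eq0.
apply: contra_notP nu => /eqP r0.
have [|y yE] := @sgval_exists (fps_inv (sgval r)).
  by apply: fps_inv_supp; [exact: semigroup0 | exact: semigroupD | exact: sgvalP].
by exists y; apply: val_inj; rewrite /= -[RHS](fps_mulV r0) -yE.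
Qed.

Variables (S : set (fps_over k s)) (P : pred nat).
Hypothesis SP : forall f : fps_over k s, f \in span_pred S <-> forall n, fpscoef f n != 0 -> P n.
Let K : lmodType R := span_mod S.

(* [n] represents the exponent [n - e], so that exponents [>= - e] are covered. *)
Let P' n := (e <= n)%N && P (n - e)%N.

(** These are the monomials spanning the socle of [k((t))/K]. As [t^e] multiplies such a monomial
    into [K], its exponent is at least [- e], so the shift by [e] loses none. *)
Definition socle_exponent n :=
  ~~ P' n /\ forall h, semigroup s h -> (0 < h)%N -> P' (n + h)%N.

(** Multiplication by [t^(j-e)] as a map m -> K; elements of m have no terms below [t^e], so the
    shift is an exact division. When [j] is a socle exponent, the default [0] can only occur outside
    m. *)
Definition socle_hom j (x : R) : K :=
  insubd (0 : K) (fpsXn k j * fps_shift e (sgval x) : fps_over k s).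

Lemma socle_homE j x : socle_exponent j -> nonunits x ->
  spanval (socle_hom j x) = fpsXn k j * fps_shift e (sgval x).
Proof.
move=> [_ soc] /nonunitsP x0; apply: (insubdK (0 : K)); apply/SP => n.
rewrite fpscoefXnM; case: leqP => [le_jn|]; last by rewrite eqxx.
move=> nz; have Hh := sgvalP nz.
have h0 : (0 < n - j + e)%N by rewrite addn_gt0 s_pos orbT.
by have := soc _ Hh h0; rewrite addnA subnKC // /P' addnK => /andP[].
Qed.

Lemma socle_hom_on j : socle_exponent j -> hom_on (@nonunits R) (socle_hom j).
Proof.
move=> soc r x y mx my; apply: val_inj.
have x0 := (nonunitsP x).1 mx; have y0 := (nonunitsP y).1 my.
have mrxy : nonunits (r * x + y).
  by apply/nonunitsP; rewrite [LHS]fpscoefD fpscoefM0 x0 y0 mulr0 addr0.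
rewrite [LHS]socle_homE // [RHS]/= -[RHS]/(sgval r * spanval (socle_hom j x) + spanval (socle_hom j y)).
rewrite !socle_homE // mulrCA -mulrDr -(@fps_shiftM _ e (sgval r)) => [|i lt_i].
  by [].
by case: (posnP i) => [->//|i0]; rewrite sgval_small ?i0.
Qed.

Lemma hom_onZ (m : set R) (C : lmodType R) (phi : R -> C) :
  hom_on m phi -> m 0 -> forall r x, m x -> phi (r * x) = r *: phi x.
Proof.
move=> hom m0 r x mx.
have phi0 : phi 0 = 0.
  by have /esym/eqP := hom 1 0 0 m0 m0; rewrite mulr0 addr0 scale1r addrC eq_sym -subr_eq subrr => /eqP.
by have := hom r x 0 mx m0; rewrite addr0 phi0 addr0.
Qed.

(* Two distinct socle exponents would give linearly independent classes in *)
(* Ext^1(R/m, K).                                                          *)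
Lemma socle_exponent_unique j1 j2 : ext1_residue_dim1 K ->
  socle_exponent j1 -> socle_exponent j2 -> j1 = j2.
Proof.
move=> [phi [hom_phi _ gen]] soc1 soc2; apply/eqP/negPn/negP => neq.
have [r1 [c1 E1]] := gen _ (socle_hom_on soc1).
have [r2 [c2 E2]] := gen _ (socle_hom_on soc2).
(* The classes are compared at [X = t^e], where [socle_hom j] takes the value [t^j]. *)
have [X XE] := sgvalXn (semigroup_gen s ord0).
have mX : nonunits X.
  by apply/nonunitsP; rewrite XE fpscoefXn ltn_eqF.
have m0 : nonunits (0 : R) by apply/nonunitsP.
(* If [rho = be1 r1 + be2 r2] is in m, then [phi (rho X) = X phi rho], so [be1 t^j1 + be2 t^j2] lies
   in [t^e K]; but neither exponent is in [P']. *)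
have key be1 be2 : be1 * fpscoef (sgval r1) 0 + be2 * fpscoef (sgval r2) 0 = 0 ->
    be1 = 0 /\ be2 = 0.
  have [b1 b1E] := sgvalC be1; have [b2 b2E] := sgvalC be2 => rho0.
  pose rho := b1 * r1 + b2 * r2.
  have mrho : nonunits rho.
    by apply/nonunitsP; rewrite -[LHS]/(fpscoef (sgval b1 * sgval r1 + sgval b2 * sgval r2) 0) b1E b2E fpscoefD !fpscoefCM.
  have E : b1 *: socle_hom j1 X + b2 *: socle_hom j2 X = X *: (phi rho + b1 *: c1 + b2 *: c2).
    rewrite !scalerDr -(hom_onZ hom_phi) // mulrC (hom_onZ hom_phi) //.
    by rewrite E1 // E2 // !scalerDr !scalerA ![X * _]mulrC scalerDl addrACA addrA.
  have V n : be1 * (n == j1)%:R + be2 * (n == j2)%:R =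
      fpscoef (fpsXn k e * spanval (phi rho + b1 *: c1 + b2 *: c2)) n.
    have EV : fpscoef (sgval b1 * spanval (socle_hom j1 X) + sgval b2 * spanval (socle_hom j2 X)) n =
      fpscoef (sgval X * spanval (phi rho + b1 *: c1 + b2 *: c2)) n :=
      congr1 (fun c : K => fpscoef (spanval c) n) E.
    rewrite -XE -EV.
    have sE : fps_shift e (fpsXn k (s ord0)) = 1.
      by rewrite -[fpsXn k _]mulr1 fps_shiftXn.
    by rewrite !socle_homE // XE sE !mulr1 b1E b2E fpscoefD !fpscoefCM !fpscoefXn.
  have V0 n : ~~ P' n -> be1 * (n == j1)%:R + be2 * (n == j2)%:R = 0.
    move=> nP; rewrite V fpscoefXnM; case: leqP => // le_en.
    apply/eqP/negPn/negP => nz; case/negP: nP; rewrite /P' le_en /=.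
    by apply: (SP _).1 nz; apply: valP.
  have := V0 _ soc1.1; have := V0 _ soc2.1.
  by rewrite !eqxx [j2 == _]eq_sym (negbTE neq) !mulr0 !mulr1 addr0 add0r.
(* [key] makes the two residues linearly independent over [k], which is impossible for two
   scalars. *)
have [r20 /eqP] : fpscoef (sgval r2) 0 = 0 /\ - fpscoef (sgval r1) 0 = 0.
  by apply: key; rewrite mulNr mulrC subrr.
rewrite oppr_eq0 => /eqP r10.
have [/eqP] : (1 : k) = 0 /\ (1 : k) = 0 by apply: key; rewrite r10 r20 !mulr0 addr0.
by rewrite oner_eq0.
Qed.

(* With [F] the largest exponent outside [P], duality gives P = F - (Z \ H), *)
(* and [a] in the multiplier semigroup of [P] forces [F - a] outside [P].    *)
Lemma multiplier_in_semigroup a :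
    ext1_residue_dim1 K -> (a < e)%N -> (exists N, forall n, (N <= n)%N -> P n) ->
    (forall n, P n -> P (a + n)%N) ->
  semigroup s a.
Proof.
move=> ext lt_ae [N PN] aP.
have bnd n : ~~ P' n -> (n <= N + e)%N.
  by rewrite /P'; apply: contraR; rewrite -ltnNge => lt_n; rewrite PN; lia.
(* The index [e - 1] stands for exponent -1, so a gap always exists and the largest one satisfies
   [F >= e - 1 >= a]. *)
have e1 : ~~ P' e.-1 by rewrite /P' leqNgt prednK // leqnn.
case: (ex_maxnP (ex_intro (fun n => ~~ P' n) _ e1) bnd) => F nF maxF.
have le_aF : (a <= F)%N by apply: leq_trans (maxF _ e1); rewrite -ltnS prednK.
have socF : socle_exponent F.
  split=> // h _ h0; apply/negPn/negP => /maxF.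
  by rewrite leqNgt -[ltnLHS]addn0 ltn_add2l h0.
have nFa : ~~ P' (F - a)%N.
  apply: contra nF => /andP[le_e /aP PF]; apply/andP; split; first by lia.
  by rewrite (_ : F - e = a + (F - a - e))%N //; lia.
(* Climbing from the gap [F - a] by a maximal element [h] of H that still lands in a gap gives a
   socle exponent; by uniqueness it is [F], so [h = a]. *)
pose Q h := semigroup s h && ~~ P' (F - a + h)%N.
have Q0 : Q 0%N by rewrite /Q semigroup0 addn0.
have bndQ h : Q h -> (h <= N + e)%N.
  by case/andP=> _ /bnd; apply: leq_trans; rewrite leq_addl.
case: (ex_maxnP (ex_intro (fun h => Q h) _ Q0) bndQ) => h /andP[Hh nPh] maxh.
have soch : socle_exponent (F - a + h).
  split=> // h' Hh' h'0; apply/negPn/negP => nP.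
  have /maxh : Q (h + h')%N by rewrite /Q semigroupD // addnA.
  by rewrite leqNgt -[ltnLHS]addn0 ltn_add2l h'0.
by have FE := socle_exponent_unique ext socF soch; rewrite (_ : a = h) //; lia.
Qed.

End CanonicalSemigroupModule.

(** * The exponents of [K], and elements of powers of an ideal *)

Section CanonicalIdealRoot.
Variables (k : fieldType) (q : nat) (s : 'I_q.+1 -> nat).
Hypotheses (s_pos : (0 < s ord0)%N) (s_incr : forall i j : 'I_q.+1, (i < j)%N -> (s i < s j)%N).
Variables a b : nat.
Let R : comNzRingType := sgring k s.
Let S : set (fps_over k s) := [set tpow k s 0; tpow k s a; tpow k s b]%classic.
Let K : lmodType R := span_mod S.

Definition canonical_exponent : pred nat := fun n =>
  [|| semigroup s n, (a <= n)%N && semigroup s (n - a)%N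
    | (b <= n)%N && semigroup s (n - b)%N].

Lemma fpscoef_sum (I : finType) (F : I -> fps k) n :
  fpscoef (\sum_i F i) n = \sum_i fpscoef (F i) n.
Proof. exact: (big_morph (fun f : fps k => fpscoef f n) (fun f g => fpscoefD f g n)). Qed.

Lemma span_tpowP (f : fps_over k s) :
  f \in span_pred S <-> forall n, fpscoef f n != 0 -> canonical_exponent n.
Proof.
split=> [/asboolP[m [r [x [Sx ->]]]] n nz|supp].
  have [i] : exists i, fpscoef (sgval (r i) * x i) n != 0.
    apply/existsP; apply: contraNT nz => /existsPn z.
    by rewrite fpscoef_sum big1 // => i _; apply/eqP/negPn/z.
  have mem d : fpscoef (sgval (r i) * fpsXn k d) n != 0 -> (d <= n)%N && semigroup s (n - d)%N.
    by rewrite mulrC fpscoefXnM; case: leqP => [_ /sgvalP->|]; rewrite ?eqxx.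
  rewrite /canonical_exponent; case: (Sx i) => [[]|] -> /mem.
  - by rewrite subn0 => /= ->.
  - by move=> ->; rewrite orbT.
  - by move=> ->; rewrite !orbT.
(* Each term of [f] goes to the first of H, a + H, b + H containing its exponent; [r0], [r1], [r2]
   collect the shares. *)
pose Ha n := (a <= n)%N && semigroup s (n - a)%N.
have [r0 r0E] : exists r : R, sgval r = Fps (fun n => if semigroup s n then fpscoef f n else 0).
  by apply: sgval_exists => // n /=; case: ifP => //; rewrite eqxx.
have [r1 r1E] : exists r : R, sgval r =
    Fps (fun n => if semigroup s n && ~~ semigroup s (n + a)%N then fpscoef f (n + a) else 0).
  by apply: sgval_exists => // n /=; case: ifP => [/andP[]|]; rewrite ?eqxx.
have [r2 r2E] : exists r : R, sgval r =
    Fps (fun n => if [&& semigroup s n, ~~ semigroup s (n + b)%N & ~~ Ha (n + b)%N]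
                  then fpscoef f (n + b) else 0).
  by apply: sgval_exists => // n /=; case: ifP => [/andP[]|]; rewrite ?eqxx.
have S0 : S (tpow k s 0) by left; left.
have Sa : S (tpow k s a) by left; right.
have Sb : S (tpow k s b) by right.
apply/asboolP; exists 3%N, (fun i => nth r0 [:: r0; r1; r2] i),
  (fun i => nth (tpow k s 0) [:: tpow k s 0; tpow k s a; tpow k s b] i).
split; first by case=> -[|[|[|//]]].
rewrite !big_ord_recl big_ord0 /= addr0; apply: fpsP => n.
rewrite -[RHS]/(fpscoef (sgval r0 * 1 + (sgval r1 * fpsXn k a + sgval r2 * fpsXn k b)) n).
rewrite mulr1 [sgval r1 * _]mulrC [sgval r2 * _]mulrC !fpscoefD !fpscoefXnM r0E r1E r2E /=.
have := supp n; rewrite /canonical_exponent /Ha.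
case le_a: (a <= n)%N; case le_b: (b <= n)%N; rewrite ?subnK ?le_a //.
all: move: (fpscoef f n) (semigroup s n) (semigroup s (n - a)%N) (semigroup s (n - b)%N) => c [] [] [] /=.
all: rewrite ?addr0 ?add0r //.
all: by case: (eqVneq c 0) => // _ /(_ isT).
Qed.

Lemma span_tpow d : S (tpow k s d) -> exists c : K, spanval c = fpsXn k d.
Proof.
move=> Sd; have Kd : tpow k s d \in span_pred S.
  by apply/asboolP; exists 1%N, (fun=> 1), (fun=> tpow k s d); rewrite big_ord1 scale1r.
by exists (SpanMod Kd).
Qed.

Lemma ideal_power_prod (J : {pred R^o}) n (y : 'I_n -> R) :
  (forall i, y i \in J) -> exists Y : ideal_power J n, spanval Y = \prod_i y i.
Proof.
move=> Jy; rewrite /ideal_power; set S' := (X in span_mod X).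
have Sy : (\prod_i y i : R^o) \in span_pred S'.
  apply/asboolP; exists 1%N, (fun=> 1), (fun=> \prod_i y i); split; first by exists y.
  by rewrite big_ord1 scale1r.
by exists (SpanMod Sy).
Qed.

Lemma sgval_prod n (y : 'I_n -> R) : sgval (\prod_i y i) = \prod_i sgval (y i).
Proof. exact: (big_morph (fun r : R => sgval r)). Qed.

(** If [J] lies in [f T], each generating product lies in [f^n T], and [T], containing [R], absorbs
    the coefficients. [T] is later all of [k[[t]]] or a truncated subring. *)
Lemma ideal_power_sub (J : {pred R^o}) n (T : {pred fps k}) (f : fps k) :
    subring_closed T -> (forall r : R, sgval r \in T) ->
    (forall x : R, x \in J -> exists2 z, z \in T & sgval x = f * z) ->
  forall Y : ideal_power J n, exists2 z, z \in T & sgval (spanval Y) = f ^+ n * z.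
Proof.
move=> [T1 TB TM] RT JT [y Sy] /=.
have /asboolP[m [r [x [Jx ->]]]] := Sy.
have T0 : 0 \in T by rewrite -(subrr 1) TB.
have TD : {in T &, forall u v, u + v \in T}.
  by move=> u v Tu Tv; rewrite -[v]opprK TB // -sub0r TB.
have Tx i : exists2 z, z \in T & sgval (x i) = f ^+ n * z.
  have [w [Jw ->]] := Jx i; rewrite sgval_prod.
  pose z i := cid2 (JT _ (Jw i)).
  exists (\prod_i s2val (z i)); first by apply: (big_ind (fun u => u \in T)) => // j _; case: (z j).
  by rewrite -[n in f ^+ n]card_ord -prodr_const -big_split; apply: eq_bigr => j _; case: (z j).
pose z i := cid2 (Tx i).
exists (\sum_i sgval (r i) * s2val (z i)).
  by apply: (big_ind (fun u => u \in T)) => // i _; apply: TM => //; case: (z i).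
rewrite mulr_sumr; transitivity (\sum_i sgval (r i * x i)).
  exact: (big_morph (fun r : R => sgval r)).
by apply: eq_bigr => i _; rewrite mulrCA; case: (z i) => ? _ /= <-.
Qed.

Lemma ideal_power_valZ (J : {pred R^o}) n (r : R) (Y : ideal_power J n) :
  sgval (spanval (r *: Y)) = sgval r * sgval (spanval Y).
Proof. by []. Qed.

(** * The isomorphism as a multiplication, and normalization of the root *)

Section PowerIso.
Hypothesis s_gcd : \big[gcdn/0%N]_i s i = 1%N.
Variables (J : {pred R^o}) (n : nat) (F : {linear (ideal_power J n : lmodType R) -> K}) (G : K -> ideal_power J n).
Hypotheses (FK : cancel F G) (GK : cancel G F).

(** Linear maps between fractional ideals are multiplications; [phi] is the image of [1] under
    [G]. *)
Lemma power_iso_mul : exists2 phi : fps k, phi != 0 &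
  (forall Y : ideal_power J n, sgval (spanval Y) = phi * spanval (F Y)) /\
  (forall c : K, exists Y : ideal_power J n, sgval (spanval Y) = phi * spanval c).
Proof.
have [|one oneE] := span_tpow (d := 0); first by left; left.
pose phi := sgval (spanval (G one)).
have mulE (Y : ideal_power J n) : sgval (spanval Y) = phi * spanval (F Y).
  (* [t^N], with [N] beyond all gaps of H, multiplies [k[[t]]] into [R]. So [X * F Y] is a scalar
     [r], linearity gives [X Y = r phi], and [X] cancels. *)
  have [N HN] := semigroup_cofinite s_gcd.
  have [X XE] := sgvalXn k s_pos s_incr (HN _ (leqnn N)).
  have [|r rE] := @sgval_exists k q s s_pos s_incr (fpsXn k N * spanval (F Y)).
    by move=> i; rewrite fpscoefXnM; case: leqP => [/HN//|]; rewrite eqxx.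
  have FE : F (X *: Y) = F (r *: G one).
    rewrite !linearZ GK; apply: val_inj.
    by rewrite -[LHS]/(sgval X * spanval (F Y)) -[RHS]/(sgval r * spanval one) oneE mulr1 rE XE.
  have : sgval X * sgval (spanval Y) = sgval r * phi.
    by rewrite -!ideal_power_valZ (can_inj FK FE).
  by rewrite rE XE -mulrA [_ * phi]mulrC => /fpsXn_lreg.
exists phi; last by split=> // c; exists (G c); rewrite mulE GK.
apply/eqP => phi0; have : G one = G 0.
  by apply: val_inj; apply: val_inj; rewrite [LHS]mulE [RHS]mulE phi0 !mul0r.
move/(can_inj GK)/(congr1 (fun c : K => spanval c)); rewrite oneE.
by move/eqP; apply/negP/oner_neq0.
Qed.

(* [I] is the fractional ideal [f^-1 J], where [f] has minimal order in [J]; *)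
(* then [I ^ n = z K] for a unit [z] of [k[[t]]].                            *)
Lemma power_root_normalized : submod_closed J -> (1 < n)%N ->
  exists (I : {pred fps k}) (z : fps k),
    [/\ 1 \in I,
        forall (r : R) x y, x \in I -> y \in I -> sgval r * x + y \in I,
        fpscoef z 0 != 0,
        forall x y i, x \in I -> y \in I -> has_order (x * y) i -> canonical_exponent i
      & forall T : {pred fps k}, subring_closed T -> (forall r : R, sgval r \in T) ->
          {subset I <= T} -> forall c : K, z * spanval c \in T].
Proof.
move=> [J0 JD] n_gt1; have [phi phi0 [phiP phi_ex]] := power_iso_mul.
have phi_reg : GRing.lreg phi.
  have [m phim] : exists m, fpscoef phi m != 0.
    apply/not_existsP => z; case/eqP: phi0; apply: fpsP => m.
    by apply/eqP/negPn/negP/z.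
  exact: fps_lreg phim.
have clT : subring_closed [pred _ : fps k | true] by [].
have [|one oneE] := span_tpow (d := 0); first by left; left.
have [Y1 Y1E] := phi_ex one; rewrite oneE mulr1 in Y1E.
pose Q m := `[< exists2 x : R, x \in J & fpscoef (sgval x) m != 0 >].
(* If every element of [J] were zero, [J^n] would be too, although it contains [phi]. *)
have exQ : exists m, Q m.
  apply/not_existsP => no.
  have [x Jx|w _ w0] := @ideal_power_sub J n _ 0 clT (fun=> isT) _ Y1.
    exists 0 => //; rewrite mulr0; apply: fpsP => m; apply/eqP/negPn/negP => nz.
    by apply: (no m); apply/asboolP; exists x.
  by case/eqP: phi0; rewrite -Y1E w0 expr0n gtn_eqF ?mul0r // ltnW.
case: (ex_minnP exQ) => m /asboolP[x0 Jx0 x0m] min_m.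
have low (x : R) i : x \in J -> (i < m)%N -> fpscoef (sgval x) i = 0.
  move=> Jx lt_im; apply/eqP/negPn/negP => nz.
  by have /min_m : Q i; [apply/asboolP; exists x | rewrite leqNgt lt_im].
pose f := sgval x0.
have ford : has_order f m by split=> // i; apply: low.
have freg : GRing.lreg (f ^+ n) by apply: lregX; apply: fps_lreg x0m.
have fdvd (x : R) : x \in J -> exists2 w, w \in [pred _ : fps k | true] & sgval x = f * w.
  by move=> Jx; have [|w wE] := fps_dvd ford (g := sgval x); [move=> i; apply: low | exists w].
have [z _ phiE] := ideal_power_sub clT (fun=> isT) fdvd Y1; rewrite Y1E in phiE.
pose I : {pred fps k} := fun x => `[< exists2 y : R, y \in J & sgval y = f * x >].
have Iprod (x : 'I_n -> fps k) : (forall i, x i \in I) ->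
    exists c : K, \prod_i x i = z * spanval c.
  move=> Ix; pose y i := cid2 (asboolW (Ix i)).
  have [|Y YE] := @ideal_power_prod J n (fun i => s2val (y i)).
    by move=> i; case: (y i).
  exists (F Y); apply: freg; rewrite mulrA -phiE -phiP YE sgval_prod.
  rewrite -[n in f ^+ n]card_ord -prodr_const -big_split /=.
  by apply: eq_bigr => i _; case: (y i).
have I1 : 1 \in I by apply/asboolP; exists x0; rewrite // mulr1.
(* Since [1] is in [I], the product of [n] copies of it is in [z K]; hence [z] is a unit with
   inverse [u]. *)
have [u uE] : exists u : K, 1 = z * spanval u.
  by have [//|u uE] := Iprod (fun=> 1); exists u; rewrite -uE big1.
have uz0 : fpscoef (spanval u) 0 * fpscoef z 0 = 1.
  by rewrite mulrC -fpscoefM0 -uE.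
exists I, z; split=> //.
- move=> r x y /asboolP[x' Jx' xE] /asboolP[y' Jy' yE]; apply/asboolP.
  exists (r * x' + y'); first exact: JD.
  by rewrite -[LHS]/(sgval r * sgval x' + sgval y') xE yE mulrDr mulrCA.
- by apply/eqP => z0; move/eqP: uz0; rewrite z0 mulr0 eq_sym oner_eq0.
- move=> x y i Ix Iy xy_i; pose i0 := Ordinal (ltnW n_gt1); pose i1 := Ordinal n_gt1.
  (* Here [n > 1] enters: [x y] padded with ones is a product of [n] elements of [I]. Multiplying by
     [u], of order 0, gives an element of [K] of the same order. *)
  have [j|c] := Iprod (fun j => if j == i0 then x else if j == i1 then y else 1).
    by case: ifP => // _; case: ifP.
  rewrite (bigD1 i0) // (bigD1 i1) //= big1 ?mulr1 => [xyE|j /andP[/negbTE-> /negbTE->] //].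
  have u0 : has_order (spanval u : fps k) 0.
    by split=> //; apply/eqP => u0; move/eqP: uz0; rewrite u0 mul0r eq_sym oner_eq0.
  have := has_orderM u0 xy_i; rewrite xyE mulrA [_ * z]mulrC -uE mul1r add0n.
  by case=> ci _; apply: (span_tpowP _).1 ci; apply: valP.
move=> T clT' RT IT c; have [Y YE] := phi_ex c.
have [x Jx|w Tw wE] := ideal_power_sub clT' RT _ Y (f := f).
  have [w _ wE] := fdvd _ Jx; exists w => //.
  by apply: IT; apply/asboolP; exists x.
by rewrite (_ : z * _ = w) //; apply: freg; rewrite mulrA -phiE -YE wE.
Qed.

End PowerIso.

(** * Orders occurring in the normalized root *)

Hypotheses (a_pos : (0 < a)%N) (ab : (a < b)%N) (b_neq : b <> (2 * a)%N) (b_lt : (b < s ord0)%N).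

Lemma canonical_exponent_small i : (i <= b)%N -> canonical_exponent i -> [\/ i = 0, i = a | i = b]%N.
Proof.
move=> le_ib; case/or3P => [/(semigroup_lt s_incr)|/andP[le /(semigroup_lt s_incr)]|/andP[le /(semigroup_lt s_incr)]] E.
- by constructor 1; apply: E; lia.
- by constructor 2; have := E _; lia.
- by constructor 3; lia.
Qed.

Lemma multiplier_of_root (I : {pred fps k}) (z : fps k) :
    1 \in I ->
    (forall (r : R) x y, x \in I -> y \in I -> sgval r * x + y \in I) ->
    fpscoef z 0 != 0 ->
    (forall x y i, x \in I -> y \in I -> has_order (x * y) i -> canonical_exponent i) ->
    (forall T : {pred fps k}, subring_closed T -> (forall r : R, sgval r \in T) ->
          {subset I <= T} -> forall c : K, z * spanval c \in T) ->
  forall i, canonical_exponent i -> canonical_exponent (a + i)%N.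
Proof.
move=> I1 ID z0 IP IT.
have IPs x i : x \in I -> has_order x i -> canonical_exponent i.
  by move=> Ix xi; apply: (IP x 1) => //; rewrite mulr1.
have low x i : x \in I -> fpscoef x 0 = 0 -> (i <= b)%N -> fpscoef x i != 0 ->
    exists m, [/\ (m <= i)%N, has_order x m & m = a \/ m = b].
  move=> Ix x0 le_ib /has_order_exists[m le_mi xm]; exists m; split=> //.
  case: (canonical_exponent_small _ (IPs _ _ Ix xm)) => [|m0||]; [lia| |by left|by right].
  by case: xm; rewrite m0 x0 eqxx.
have subC x c y : x \in I -> y \in I -> y - fpsC c * x \in I.
  move=> Ix Iy; have [r rE] := sgvalC s_pos s_incr (- c).
  suff -> : y - fpsC c * x = sgval r * x + y by apply: ID.
  by rewrite rE addrC; congr (_ + _); apply: fpsP => i; rewrite -[LHS]/(- fpscoef _ i) !fpscoefCM mulNr.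
have [ca caE] : exists c : K, spanval c = fpsXn k a by apply: span_tpow; left; right.
have [cb cbE] : exists c : K, spanval c = fpsXn k b by apply: span_tpow; right.
have RT N g : (N <= b)%N -> forall r : R, sgval r \in trunc_line N g.
  move=> le_N r; apply/asboolP; exists 0 => i iN; rewrite mul0r.
  by apply: sgval_small => //; lia.
(* Without an order [a], elements of [I] are constant modulo [t^(a+1)], and then so is [z t^a],
   whose coefficient at [a] is [z(0)]. *)
case: (pselect (exists2 g, g \in I & has_order g a)) => [[g Ig ga]|noa]; last first.
  have : z * spanval ca \in trunc_line a 0.
    apply: IT; [by apply: trunc_line_subring => i j _ _ _; rewrite mul0r | by apply: RT; lia|].
    move=> x Ix; apply/asboolP; exists 0 => i /andP[i0 le_ia]; rewrite mul0r.
    apply/eqP/negPn/negP => nz; pose y := x - fpsC (fpscoef x 0) * 1.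
    have yE j : (0 < j)%N -> fpscoef y j = fpscoef x j.
      by move=> j0; rewrite fpscoefB fpscoefCM fpscoef1 gtn_eqF // mulr0 subr0.
    have y0 : fpscoef y 0 = 0 by rewrite fpscoefB fpscoefCM fpscoef1 mulr1 subrr.
    have Iy : y \in I by apply: subC.
    have [||m [le_mi ym [mE|mE]]] := low y i Iy y0; rewrite ?yE //; try lia.
    by apply: noa; exists y; rewrite -?mE.
  case/asboolP => be /(_ a); rewrite a_pos leqnn => /(_ isT).
  rewrite [z * _]mulrC caE fpscoefXnM leqnn subnn => zE.
  by case/eqP: z0; rewrite zE; apply: mulr0.
case: (pselect (exists2 h, h \in I & has_order h b)) => [[h Ih hb]|nob]; last first.
  (* The order [2 a] of [g^2] is an exponent of [K]; if it were at most [b], it would be [0], [a] or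
     [b]. *)
  have le_2a : (b < 2 * a)%N.
    have : canonical_exponent (a + a) by apply: (IP g g) => //; apply: has_orderM.
    rewrite ltnNge => H2; apply/negP => le.
    by case: (canonical_exponent_small _ H2); lia.
  have [ga0 g0] := ga.
  have : z * spanval cb \in trunc_line b g.
    apply: IT; [| exact: RT |].
      apply: trunc_line_subring => i j i0 j0 le.
      have [lt_i|lt_j] : (i < a)%N \/ (j < a)%N by lia.
        by rewrite g0 // mul0r.
      by rewrite [X in _ * X]g0 // mulr0.
    move=> x Ix; apply/asboolP; pose c := fpscoef x a / fpscoef g a.
    exists c => i /andP[i0 le_ib].
    (* The coefficients at 0 and [a] are cleared, so a surviving term up to [b] would force order
       [b]. *)
    pose y := x - fpsC (fpscoef x 0) * 1 - fpsC c * g.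
    have yE j : (0 < j)%N -> fpscoef y j = fpscoef x j - c * fpscoef g j.
      by move=> j0; rewrite !fpscoefB !fpscoefCM fpscoef1 gtn_eqF // mulr0 subr0.
    have y0 : fpscoef y 0 = 0 by rewrite !fpscoefB !fpscoefCM fpscoef1 mulr1 subrr g0 // mulr0 subr0.
    have ya : fpscoef y a = 0 by rewrite yE // /c mulfVK // subrr.
    have Iy : y \in I by exact: (subC _ _ _ Ig (subC _ _ _ I1 Ix)).
    apply/eqP; rewrite -subr_eq0 -yE //; apply/negPn/negP => nz.
    have [m [le_mi ym [mE|mE]]] := low y i Iy y0 le_ib nz.
      by case: ym; rewrite mE ya eqxx.
    by apply: nob; exists y; rewrite -?mE.
  (* At [a] the series [z t^b] vanishes and [g] does not, so [be = 0]; at [b] this gives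
     [z(0) = 0]. *)
  case/asboolP => be zb.
  have := zb b; rewrite (ltn_trans a_pos ab) leqnn => /(_ isT).
  rewrite [z * _]mulrC cbE fpscoefXnM leqnn subnn => zE.
  have := zb a; rewrite a_pos (ltnW ab) => /(_ isT).
  rewrite [z * _]mulrC cbE fpscoefXnM leqNgt ab /= => /esym/eqP.
  rewrite mulf_eq0 (negbTE ga0) orbF => /eqP be0.
  by case/eqP: z0; rewrite zE be0 mul0r.
(* Monomials of [R] times [1], [g] and [h] realize H, a + H and b + H. *)
have Iex i : canonical_exponent i -> exists2 x, x \in I & has_order x i.
  have mulH x m l : x \in I -> has_order x m -> semigroup s l -> exists2 y, y \in I & has_order y (l + m).
    move=> Ix xm Hl; have [r rE] := sgvalXn k s_pos s_incr Hl.
    exists (fpsXn k l * x); last by apply: has_orderM => //; apply: has_orderXn.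
    rewrite -rE -[_ * _]addr0; apply: ID => //.
    have := subC 1 1 1 I1 I1; suff -> : 1 - fpsC 1 * 1 = 0 :> fps k by [].
    by apply: fpsP => j; rewrite fpscoefB fpscoefCM mul1r subrr.
  case/or3P => [Hi|/andP[le Hi]|/andP[le Hi]].
  - by have := mulH _ _ _ I1 (has_orderXn k 0) Hi; rewrite addn0.
  - by have := mulH _ _ _ Ig ga Hi; rewrite subnK.
  - by have := mulH _ _ _ Ih hb Hi; rewrite subnK.
by move=> i /Iex[x Ix xi]; apply: (IP g x) => //; apply: has_orderM.
Qed.

End CanonicalIdealRoot.

Theorem theorem5p14 (k : fieldType) (q : nat) (s : 'I_q.+1 -> nat)
    (s_pos : (0 < s ord0)%N)
    (s_incr : forall i j : 'I_q.+1, (i < j)%N -> (s i < s j)%N)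
    (s_gcd : \big[gcdn/0%N]_i s i = 1%N)
    (a b : nat) (a_pos : (0 < a)%N) (ab : (a < b)%N) :
  let R : comNzRingType := sgring k s in
  let K : lmodType R :=
    span_mod [set tpow k s 0; tpow k s a; tpow k s b]%classic in
  canonical_module K ->
  cm_type R 3 ->
  b <> (2 * a)%N ->
  (b < s ord0)%N ->
  forall J : {pred R^o}, submod_closed J ->
  forall n : nat, (1 <= n)%N ->
  lmod_iso (ideal_power J n) K ->
  n = 1%N.
Proof.
move=> R K [_ _ ext _] _ b_neq b_lt J Jsub n n_pos [F [G FK GK]].
apply/eqP; rewrite eqn_leq n_pos andbT leqNgt; apply/negP => n_gt1.
have [I [z [I1 ID z0 IP IT]]] := power_root_normalized s_pos s_incr s_gcd FK GK Jsub n_gt1.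
have aP := multiplier_of_root s_pos s_incr a_pos ab b_neq b_lt I1 ID z0 IP IT.
have [N HN] := semigroup_cofinite s_gcd.
have cof : exists N, forall i, (N <= i)%N -> canonical_exponent s a b i.
  by exists N => i /HN Hi; rewrite /canonical_exponent Hi.
have lt_as := ltn_trans ab b_lt.
have /(semigroup_lt s_incr)-/(_ lt_as) aE := multiplier_in_semigroup s_pos s_incr
  (span_tpowP s_pos s_incr a b) ext lt_as cof aP.
by rewrite aE in a_pos.
Qed.
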